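(* Let $Q$ be a quandle and let $N_1, N_2 \subseteq \mathrm{Inn}(Q)$ be realizable kernels. For $i=1,2$ let $g_{N_i}: Q \to Q/N_i$, $g_{N_i}(q) = q\cdot N_i$, be the corresponding orbit quotient, where $q\cdot N_i$ denotes the orbit of $q$ under the action of $N_i$. Then there is a quandle homomorphism $\Omega: Q/N_1 \to Q/N_2$ such that $\Omega\circ g_{N_1} = g_{N_2}$ if and only if $N_1 \subseteq N_2$.
   Context: A quandle is a set $Q$ with two binary operations $\rhd, \rhd^{-1}$ such that for all $x,y,z\in Q$: (i) $x\rhd x = x$; (ii) $(x\rhd y)\rhd^{-1} y = x = (x\rhd^{-1} y)\rhd y$; (iii) $(x\rhd y)\rhd z = (x\rhd z)\rhd (y\rhd z)$. A quandle homomorphism is a map $\Phi$ with $\Phi(x\rhd y) = \Phi(x)\rhd\Phi(y)$ (it then preserves $\rhd^{-1}$ as well). For $x\in Q$ the symmetry $S_x$ is the map $S_x(y) = y\rhd x$, an automorphism of $Q$. The inner automorphism group $\mathrm{Inn}(Q)$ is the group generated by all the $S_x$, regarded as acting on $Q$ on the right ($q\cdot S_x = q\rhd x$, and $q\cdot(gh) = (q\cdot g)\cdot h$). A surjective quandle homomorphism $h:Q\to R$ induces a surjective group homomorphism $\mathrm{Inn}(h):\mathrm{Inn}(Q)\to \mathrm{Inn}(R)$ determined by $S_x\mapsto S_{h(x)}$. A realizable kernel (in $\mathrm{Inn}(Q)$) is a subgroup of the form $\ker(\mathrm{Inn}(h))$ for some surjective quandle homomorphism $h:Q\to R$; it is a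 normal subgroup of $\mathrm{Inn}(Q)$. For a normal subgroup $N$ of $\mathrm{Inn}(Q)$, the orbit quotient $Q/N$ is the set of orbits of $Q$ under the action of $N$, with the (well-defined) quandle structure $(q\cdot N)\rhd (r\cdot N) = (q\rhd r)\cdot N$. *)

(* Defs.v *)
From HB Require Import structures.
From mathcomp Require Import all_boot boolp classical_sets functions.

Set Implicit Arguments.
Unset Strict Implicit.
Unset Printing Implicit Defensive.

Local Open Scope classical_set_scope.

Reserved Notation "x \rhd y" (at level 45, left associativity).
Reserved Notation "x \rhd^-1 y" (at level 45, left associativity).

HB.mixin Record isQuandle Q := {
  qop : Q -> Q -> Q;
  qinv : Q -> Q -> Q;
  qopxx : forall x, qop x x = x;
  qopK : forall y, cancel (qop^~ y) (qinv^~ y);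
  qinvK : forall y, cancel (qinv^~ y) (qop^~ y);
  qopDl : left_distributive qop qop
}.

#[short(type="quandleType")]
HB.structure Definition Quandle := {Q of isQuandle Q}.

Notation "x \rhd y" := (qop x y).
Notation "x \rhd^-1 y" := (qinv x y).

HB.mixin Record isQuandleHom (Q R : quandleType) (f : Q -> R) := {
  qhomM : {morph f : x y / x \rhd y}
}.

#[short(type="quandleHom")]
HB.structure Definition QuandleHom (Q R : quandleType) :=
  {f of isQuandleHom Q R f}.

Lemma qhomV (Q R : quandleType) (f : quandleHom Q R) :
  {morph f : x y / x \rhd^-1 y}.
Proof. by move=> x y; rewrite -[LHS](@qopK _ (f y)) -qhomM qinvK. Qed.

(* The symmetric group of an arbitrary type; products compose from left to
   right, as for {perm T}, so that it acts on T on the right. *)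
Record sym (T : Type) := Sym {
  sym_fun :> T -> T;
  sym_inv : T -> T;
  sym_funK : cancel sym_fun sym_inv;
  sym_invK : cancel sym_inv sym_fun
}.

Lemma symP T (f g : sym T) : f =1 g -> f = g.
Proof.
case: f g => [f f' fK f'K] [g g' gK g'K] /= /funext efg.
move: gK g'K; rewrite -{}efg => gK g'K.
have e : g' = f' by apply/funext => x; rewrite -{1}[x]f'K gK.
by move: gK g'K; rewrite e => gK g'K; congr Sym; exact: Prop_irrelevance.
Qed.

Section SymGroup.
Variable T : Type.
Implicit Types f g : sym T.

HB.instance Definition _ := gen_eqMixin (sym T).
HB.instance Definition _ := gen_choiceMixin (sym T).

Definition sym_one : sym T := @Sym T idfun idfun (fun=> erefl) (fun=> erefl).

Definition sym_mul f g : sym T :=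
  @Sym T (g \o f) (sym_inv f \o sym_inv g)
    (can_comp (@sym_funK _ g) (@sym_funK _ f))
    (can_comp (@sym_invK _ f) (@sym_invK _ g)).

Definition sym_opp f : sym T := Sym (@sym_invK _ f) (@sym_funK _ f).

Lemma sym_mulA : associative sym_mul.
Proof. by move=> f g h; exact: symP. Qed.

Lemma sym_mul1 : left_id sym_one sym_mul.
Proof. by move=> f; exact: symP. Qed.

Lemma sym_mulr1 : right_id sym_one sym_mul.
Proof. by move=> f; exact: symP. Qed.

Lemma sym_mulV : left_inverse sym_one sym_opp sym_mul.
Proof. by move=> f; apply: symP => x /=; rewrite sym_invK. Qed.

Lemma sym_mulrV : right_inverse sym_one sym_opp sym_mul.
Proof. by move=> f; apply: symP => x /=; rewrite sym_funK. Qed.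

HB.instance Definition _ := isGroup.Build (sym T)
  sym_mulA sym_mul1 sym_mulr1 sym_mulV sym_mulrV.

End SymGroup.

(* Subgroups of a groupType are classical sets, seen as boolean predicates. *)
Definition subgroup (G : groupType) (H : set G) : Prop := group_closed (mem H).

Definition generated (G : groupType) (A : set G) : set G :=
  smallest (@subgroup G) A.

Record normalSubgroup (G : groupType) := NormalSubgroup {
  normal_set :> set G;
  normal_subgroup : subgroup normal_set;
  normalJ : forall x g : G, normal_set x -> normal_set (x ^ g)%g
}.

Section SubgroupTheory.
Variables (G : groupType).

Lemma subgroupP (H : set G) : subgroup H <->
  H 1%g /\ (forall x y, H x -> H y -> H (x / y)%g).
Proof.
split=> -[H1 HD]; split.
- by have := H1; rewrite /= inE.
- move=> x y /mem_set Hx /mem_set Hy.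
  exact/set_mem/HD.
- exact/mem_set.
- by move=> x y /set_mem Hx /set_mem Hy; apply/mem_set/HD.
Qed.

Lemma generated_subgroup (A : set G) : subgroup (generated A).
Proof.
apply/subgroupP; split; first by move=> H [/subgroupP[]].
move=> x y Ax Ay H HA; have [/subgroupP[_ HD] _] := HA.
by apply: HD; [exact: Ax | exact: Ay].
Qed.

End SubgroupTheory.

Section Inner.
Variable Q : quandleType.

Definition symmetry (x : Q) : sym Q := Sym (@qopK Q x) (@qinvK Q x).

Definition inner : set (sym Q) := generated (range symmetry).

Definition Inn : Type := inner.

HB.instance Definition _ := SubChoice.on Inn.
HB.instance Definition _ :=
  SubChoice_isSubGroup.Build (sym Q) _ Inn (generated_subgroup _).

Lemma symmetry_inner x : symmetry x \in inner.
Proof. by apply/mem_set => H [_ HA]; apply: HA; exists x. Qed.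

Definition Inn_symmetry (x : Q) : Inn :=
  exist _ (symmetry x) (symmetry_inner x).

Definition act (q : Q) (g : Inn) : Q := (val g : sym Q) q.

Lemma act1 q : act q 1%g = q.
Proof. by []. Qed.

Lemma actM q g h : act q (g * h)%g = act (act q g) h.
Proof. by []. Qed.

Lemma actK g : cancel (act^~ g) (act^~ g^-1%g).
Proof. by move=> q; rewrite -actM mulgV. Qed.

Lemma actVK g : cancel (act^~ g^-1%g) (act^~ g).
Proof. by move=> q; rewrite -actM mulVg. Qed.

Lemma act_symmetry q x : act q (Inn_symmetry x) = q \rhd x.
Proof. by []. Qed.

Lemma act_inj g h : act^~ g =1 act^~ h -> g = h.
Proof. by move=> e; apply/val_inj/symP. Qed.

Lemma Inn_ind (P : Inn -> Prop) : P 1%g ->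
    (forall g h, P g -> P h -> P (g / h)%g) ->
    (forall x, P (Inn_symmetry x)) -> forall g, P g.
Proof.
move=> P1 PF PS g.
suff: inner `<=` [set val u | u in P].
  by move=> /(_ _ (set_mem (valP g)))[u Pu /val_inj <-].
apply: smallest_sub => [|_ [x _ <-]]; last by exists (Inn_symmetry x).
apply/subgroupP; split; first by exists 1%g.
move=> _ _ [u Pu <-] [v Pv <-]; exists (u / v)%g => //; exact: PF.
Qed.

Lemma actD (g : Inn) : {morph act^~ g : x y / x \rhd y}.
Proof.
elim/Inn_ind: g => // [g h IHg IHh x y|z x y]; last exact: qopDl.
rewrite !actM IHg; set a := act x g; set b := act y g.
by rewrite -{1}[a](actVK h) -{1}[b](actVK h) -IHh actK.
Qed.

Lemma actDV (g : Inn) : {morph act^~ g : x y / x \rhd^-1 y}.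
Proof. by move=> x y /=; rewrite -[LHS](@qopK _ (act y g)) -actD qinvK. Qed.

Lemma symmetry_act x g : Inn_symmetry (act x g) = (Inn_symmetry x ^ g)%g.
Proof.
apply: act_inj => q; rewrite !actM !act_symmetry.
by rewrite actD actVK.
Qed.

End Inner.

Section InnHom.
Variables (Q R : quandleType) (h : quandleHom Q R).
Hypothesis hsurj : set_surj setT setT h.

Lemma Inn_hom_exists : exists F : UMagmaMorphism.type (Inn Q) (Inn R),
  forall x, F (Inn_symmetry x) = Inn_symmetry (h x).
Proof.
have lift (g : Inn Q) : {g' : Inn R | forall q, act (h q) g' = h (act q g)}.
  apply: cid; elim/Inn_ind: g => [|g k [g' Hg] [k' Hk]|x].
  - by exists 1%g.
  - exists (g' / k')%g => q; rewrite !actM Hg.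
    by rewrite -{1}[act q g](actVK k) -Hk actK.
  - by exists (Inn_symmetry (h x)) => q; rewrite !act_symmetry qhomM.
have ext (u v : Inn R) : (forall q, act (h q) u = act (h q) v) -> u = v.
  by move=> e; apply: act_inj => r; have [q _ <-] := hsurj (I : setT r).
pose F g := projT1 (lift g).
have FE g q : act (h q) (F g) = h (act q g) by rewrite /F; case: (lift g).
have FM : {morph F : x y / (x * y)%g}.
  by move=> x y; apply: ext => q; rewrite actM !FE actM.
have F1 : F 1%g = 1%g by apply: ext => q; rewrite FE.
pose FisM := isMultiplicative.Build _ _ F FM.
pose FisU := Multiplicative_isUMagmaMorphism.Build _ _ F F1.
pose FU : UMagmaMorphism.type (Inn Q) (Inn R) :=
  HB.pack F FisM FisU.
exists FU => x; apply: ext => q.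
by rewrite /= FE !act_symmetry qhomM.
Qed.

(* Inn_symmetry generates Inn Q, so the choice is unique: see Inn_hom_unique. *)
Definition Inn_hom : UMagmaMorphism.type (Inn Q) (Inn R) :=
  projT1 (cid Inn_hom_exists).

Lemma Inn_hom_symmetry x : Inn_hom (Inn_symmetry x) = Inn_symmetry (h x).
Proof. exact: (projT2 (cid Inn_hom_exists)). Qed.

Lemma Inn_hom_unique (F : UMagmaMorphism.type (Inn Q) (Inn R)) :
  (forall x, F (Inn_symmetry x) = Inn_symmetry (h x)) -> F =1 Inn_hom.
Proof.
move=> FS; elim/Inn_ind => [|g k IHg IHk|x]; first by rewrite !gmulf1.
  by rewrite !gmulfF IHg IHk.
by rewrite FS Inn_hom_symmetry.
Qed.

Lemma Inn_hom_act g q : act (h q) (Inn_hom g) = h (act q g).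
Proof.
elim/Inn_ind: g q => [q|g k IHg IHk q|x q]; first by rewrite gmulf1.
  by rewrite gmulfF !actM IHg -{1}[act q g](actVK k) -IHk actK.
by rewrite Inn_hom_symmetry !act_symmetry qhomM.
Qed.

Lemma Inn_hom_surj : set_surj setT setT Inn_hom.
Proof.
move=> r _; elim/Inn_ind: r => [|_ _ [u _ <-] [v _ <-]|y].
- by exists 1%g => //; rewrite gmulf1.
- by exists (u / v)%g => //; rewrite gmulfF.
- have [x _ <-] := hsurj (I : setT y).
  by exists (Inn_symmetry x) => //; rewrite Inn_hom_symmetry.
Qed.

End InnHom.

Definition hom_ker (G H : groupType) (F : UMagmaMorphism.type G H) : set G :=
  [set g | F g = 1%g].

Lemma hom_ker_subgroup (G H : groupType) (F : UMagmaMorphism.type G H) :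
  subgroup (hom_ker F).
Proof.
apply/subgroupP; split; first exact: gmulf1.
by move=> x y; rewrite /hom_ker /= gmulfF => -> ->; rewrite divgg.
Qed.

Lemma hom_kerJ (G H : groupType) (F : UMagmaMorphism.type G H) (x g : G) :
  hom_ker F x -> hom_ker F (x ^ g)%g.
Proof. by rewrite /hom_ker /= gmulfJ => ->; rewrite conj1g. Qed.

Definition realizable_kernel (Q : quandleType) (N : set (Inn Q)) : Prop :=
  exists (R : quandleType) (h : quandleHom Q R)
         (hsurj : set_surj setT setT h), N = hom_ker (Inn_hom hsurj).

Lemma realizable_kernel_normal (Q : quandleType) (N : set (Inn Q)) :
  realizable_kernel N -> exists M : normalSubgroup (Inn Q), M = N :> set _.
Proof.
move=> [R [h [hsurj ->]]].
by exists (NormalSubgroup (hom_ker_subgroup _) (@hom_kerJ _ _ (Inn_hom hsurj))).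
Qed.

Section OrbitQuotient.
Variables (Q : quandleType) (N : normalSubgroup (Inn Q)).

Definition Inn_orbit (q : Q) : set Q := [set act q n | n in N].

Definition orbit_quotient : Type := range Inn_orbit.

Definition orbit_proj (q : Q) : orbit_quotient :=
  exist _ (Inn_orbit q) (mem_set (imageT Inn_orbit q)).

Let N1 : normal_set N 1%g.
Proof. by have [] := (subgroupP _).1 (normal_subgroup N). Qed.

Let NF x y : normal_set N x -> normal_set N y -> normal_set N (x / y)%g.
Proof. by have [_] := (subgroupP _).1 (normal_subgroup N); apply. Qed.

Let NV x : normal_set N x -> normal_set N x^-1%g.
Proof. by move=> Nx; rewrite -[(x^-1)%g]mul1g; exact: NF. Qed.

Let NM x y : normal_set N x -> normal_set N y -> normal_set N (x * y)%g.
Proof. by move=> Nx Ny; rewrite -[y]invgK; apply: NF => //; exact: NV. Qed.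

Lemma orbit_quotientP (A : orbit_quotient) : exists q, A = orbit_proj q.
Proof.
have /set_mem[q _ e] := valP A.
by exists q; apply/val_inj; rewrite /= e.
Qed.

Lemma orbit_projP q r : orbit_proj q = orbit_proj r <-> Inn_orbit q r.
Proof.
split=> [/(congr1 val) /= ->|[n Nn <-]]; first by exists 1%g.
apply/val_inj/seteqP; split=> _ /= [m Nm <-].
  exists (n^-1 * m)%g; first by apply: NM => //; exact: NV.
  by rewrite -actM mulgA mulgV mul1g.
by exists (n * m)%g => //; exact: NM.
Qed.

Lemma orbit_op q r :
  [set x \rhd y | x in Inn_orbit q & y in Inn_orbit r] = Inn_orbit (q \rhd r).
Proof.
apply/seteqP; split=> [_ [_ [n Nn <-] [_ [m Nm <-] <-]]|_ [n Nn <-]].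
  exists ((n * m^-1) ^ (Inn_symmetry r) * m)%g.
    by apply: NM => //; apply: normalJ; exact: NF.
  rewrite -!act_symmetry symmetry_act -!actM; congr act.
  by rewrite /conjg !mulgA mulgV mul1g.
exists (act q n); first by exists n.
by exists (act r n); [exists n | rewrite actD].
Qed.

Lemma orbit_opV q r :
  [set x \rhd^-1 y | x in Inn_orbit q & y in Inn_orbit r] =
  Inn_orbit (q \rhd^-1 r).
Proof.
apply/seteqP; split=> [_ [_ [n Nn <-] [_ [m Nm <-] <-]]|_ [n Nn <-]]; last first.
  exists (act q n); first by exists n.
  by exists (act r n); [exists n | rewrite actDV].
have actV a b : a \rhd^-1 b = act a (Inn_symmetry b)^-1%g by [].
exists ((n * m^-1) ^ (Inn_symmetry r)^-1 * m)%g.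
  by apply: NM => //; apply: normalJ; exact: NF.
rewrite !actV symmetry_act -!actM; congr act.
by rewrite /conjg !invgM !invgK !mulgA mulVg mul1g.
Qed.

Let op_subproof (A B : orbit_quotient) :
  [set x \rhd y | x in val A & y in val B] \in range Inn_orbit.
Proof.
have [[q ->] [r ->]] := (orbit_quotientP A, orbit_quotientP B).
by apply/mem_set; rewrite /= orbit_op; exact: imageT.
Qed.

Let opV_subproof (A B : orbit_quotient) :
  [set x \rhd^-1 y | x in val A & y in val B] \in range Inn_orbit.
Proof.
have [[q ->] [r ->]] := (orbit_quotientP A, orbit_quotientP B).
by apply/mem_set; rewrite /= orbit_opV; exact: imageT.
Qed.

(* Operating setwise avoids choosing representatives; by orbit_op and orbit_opV
   the results are the orbits of q \rhd r and q \rhd^-1 r. *)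
Definition orbit_quotient_op (A B : orbit_quotient) : orbit_quotient :=
  exist (fun C : set Q => C \in range Inn_orbit) _ (op_subproof A B).

Definition orbit_quotient_opV (A B : orbit_quotient) : orbit_quotient :=
  exist (fun C : set Q => C \in range Inn_orbit) _ (opV_subproof A B).

Let op_proj q r :
  orbit_quotient_op (orbit_proj q) (orbit_proj r) = orbit_proj (q \rhd r).
Proof. by apply/val_inj; rewrite /= orbit_op. Qed.

Let opV_proj q r :
  orbit_quotient_opV (orbit_proj q) (orbit_proj r) = orbit_proj (q \rhd^-1 r).
Proof. by apply/val_inj; rewrite /= orbit_opV. Qed.

Let opxx A : orbit_quotient_op A A = A.
Proof. by have [q ->] := orbit_quotientP A; rewrite op_proj qopxx. Qed.

Let opK B : cancel (orbit_quotient_op^~ B) (orbit_quotient_opV^~ B).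
Proof.
move=> A; have [[q ->] [r ->]] := (orbit_quotientP A, orbit_quotientP B).
by rewrite op_proj opV_proj qopK.
Qed.

Let opVK B : cancel (orbit_quotient_opV^~ B) (orbit_quotient_op^~ B).
Proof.
move=> A; have [[q ->] [r ->]] := (orbit_quotientP A, orbit_quotientP B).
by rewrite opV_proj op_proj qinvK.
Qed.

Let opDl : left_distributive orbit_quotient_op orbit_quotient_op.
Proof.
move=> A B C; have [q ->] := orbit_quotientP A.
have [[r ->] [s ->]] := (orbit_quotientP B, orbit_quotientP C).
by rewrite !op_proj qopDl.
Qed.

HB.instance Definition _ :=
  isQuandle.Build orbit_quotient opxx opK opVK opDl.

Lemma orbit_projM : {morph orbit_proj : q r / q \rhd r}.
Proof. by move=> q r; rewrite -op_proj. Qed.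

HB.instance Definition _ :=
  isQuandleHom.Build Q orbit_quotient orbit_proj orbit_projM.

End OrbitQuotient.

(* Main.v *)
Require Import Defs.
From HB Require Import structures.
From mathcomp Require Import all_boot boolp classical_sets functions.

Local Open Scope classical_set_scope.

(** A homomorphism out of [Q] factors through [Q / N] exactly when [N] preserves
    its fibres. Hence a factorization of [Q -> Q / N2] through [Q / N1] says
    that every [g] in [N1] keeps each point inside its own [N2]-orbit. This
    holds if [N1] is contained in [N2]. For the converse one must recover
    membership in [N2] from its orbits. Arbitrary normal subgroups do not allow
    this: on the quandle of transpositions of three letters, under conjugation,
    the alternating and the symmetric group are both transitive. Realizable
    kernels do ([realizable_kernel_orbitP]): if [N2] is the kernel of the map
    induced by a surjection [h : Q -> R], then [h] is constant on [N2]-orbits,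
    so an element moving points only within these orbits induces the identity
    on [R]. *)

(** Since [h] is onto, the inner automorphism of [R] induced by [g] is
    determined by how [g] permutes the fibres of [h]. *)
Lemma hom_ker_Inn_homP (Q R : quandleType) (h : quandleHom Q R)
    (hsurj : set_surj setT setT h) (g : Inn Q) :
  hom_ker (Inn_hom hsurj) g <-> forall q, h (act q g) = h q.
Proof.
split=> [kg q|hg]; first by rewrite -(Inn_hom_act hsurj) kg act1.
apply: act_inj => r; have [q _ <-] := hsurj r I.
by rewrite Inn_hom_act hg act1.
Qed.

(** A realizable kernel is the largest among the subgroups having the same
    orbits, so it can be recovered from them. *)
Lemma realizable_kernel_orbitP (Q : quandleType) (N : set (Inn Q)) (g : Inn Q) :
  realizable_kernel N -> N g <-> forall q, [set act q n | n in N] (act q g).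
Proof.
move=> [R [h [hsurj ->]]]; split=> [kg q|orb]; first by exists g.
apply/hom_ker_Inn_homP => q.
by have [n /hom_ker_Inn_homP hn <-] := orb q; exact: hn.
Qed.

(** The universal property of the orbit quotient. As [f] is a homomorphism, its
    values at representatives define one on orbits. *)
Lemma orbit_quotient_factorP (Q R : quandleType) (N : normalSubgroup (Inn Q))
    (f : quandleHom Q R) :
  (exists Omega : quandleHom (orbit_quotient N) R,
     Omega \o orbit_proj N = f :> (Q -> R)) <->
  forall n q, normal_set N n -> f (act q n) = f q.
Proof.
split=> [[Omega fE] n q Nn|fN].
  rewrite -fE /=; congr (Omega _).
  by apply/esym/orbit_projP; exists n.
pose F (A : orbit_quotient N) := f (projT1 (cid (orbit_quotientP A))).
have FE q : F (orbit_proj N q) = f q.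
  rewrite /F; case: cid => r /= /orbit_projP[n Nn <-].
  exact: fN.
have FM : {morph F : A B / A \rhd B}.
  move=> A B; have [[q ->] [r ->]] := (orbit_quotientP A, orbit_quotientP B).
  by rewrite -orbit_projM !FE qhomM.
pose FisHom := isQuandleHom.Build _ _ F FM.
pose Omega : quandleHom (orbit_quotient N) R := HB.pack F FisHom.
by exists Omega; apply/funext.
Qed.

Theorem theorem3p2 (Q : quandleType) (N1 N2 : normalSubgroup (Inn Q))
    (hN1 : realizable_kernel N1) (hN2 : realizable_kernel N2) :
  (exists Omega : quandleHom (orbit_quotient N1) (orbit_quotient N2),
     Omega \o orbit_proj N1 = orbit_proj N2) <->
  N1 `<=` N2.
Proof.
apply: (iff_trans (orbit_quotient_factorP _ _ N1 (orbit_proj N2))).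
split=> [N1fix g N1g|sN12 n q N1n].
  apply/(realizable_kernel_orbitP _ _ _ hN2) => q.
  exact/orbit_projP/esym/N1fix.
by apply/esym/orbit_projP; exists n => //; exact: sN12.
Qed.
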